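(* There exist an absolute constant $c>0$ and, for every sufficiently large $n$, a pair of length-$n$ strings of probabilities $S=p_1,\ldots,p_n$ and $S'=p'_1,\ldots,p'_n$ (all $p_i,p'_i\in[0,1]$) such that $\max_i|p_i-p'_i|$ is bounded below by a positive absolute constant, $\sum_i|p_i-p'_i|=\Theta(\sqrt n)$, and for every deletion probability $\delta\ge c/\sqrt n$ (in particular every constant $\delta\in(0,1)$), the total variation distance between the distribution of a single trace drawn from $S$ and that of a single trace drawn from $S'$ is $e^{-\Omega(\sqrt n)}$ (with the implied constants independent of $n$ and $\delta$).
   Context: Generalized trace reconstruction with deletion probability $\delta\in(0,1)$: given a string of probabilities $S=p_1,\ldots,p_n$, a trace is generated by (1) sampling a binary string $T=t_1,\ldots,t_n$ with the $t_i$ independent and $\Pr[t_i=1]=p_i$, and then (2) deleting each bit of $T$ independently with probability $\delta$ and returning the concatenation of the surviving bits (a binary string of length $\le n$). *)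

(* Defs.v *)
From HB Require Import structures.
From mathcomp Require Import all_boot all_order all_algebra.
From mathcomp Require Import reals.
From mathcomp Require Import sequences.
Set Implicit Arguments. Unset Strict Implicit. Unset Printing Implicit Defensive.
Import Order.TTheory GRing.Theory Num.Theory.
Local Open Scope ring_scope.

Section Trace.
Variables (R : realType) (n : nat).

Definition prob_string (p : 'I_n -> R) : Prop := forall i, 0 <= p i <= 1.

Definition pr_string (p : 'I_n -> R) (T : {ffun 'I_n -> bool}) : R :=
  \prod_(i < n) (if T i then p i else 1 - p i).

Definition pr_keep (d : R) (K : {set 'I_n}) : R :=
  \prod_(i < n) (if i \in K then 1 - d else d).

Definition surviving (T : {ffun 'I_n -> bool}) (K : {set 'I_n}) : seq bool :=
  [seq T i | i <- enum K].

Definition trace_prob (p : 'I_n -> R) (d : R) (w : seq bool) : R :=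
  \sum_(T : {ffun 'I_n -> bool}) \sum_(K : {set 'I_n})
     (if surviving T K == w then pr_string p T * pr_keep d K else 0).

(* Total variation distance between the trace distributions of S and S'.
   Traces are binary strings of length k <= n. *)
Definition trace_tv (p p' : 'I_n -> R) (d : R) : R :=
  2^-1 * \sum_(k < n.+1) \sum_(w : k.-tuple bool)
     `|trace_prob p d w - trace_prob p' d w|.

End Trace.

(* Main.v *)
Require Import Defs.
From HB Require Import structures.
From mathcomp Require Import all_boot all_order all_algebra.
From mathcomp Require Import reals.
From mathcomp Require Import sequences.
From mathcomp Require Import exp.
From mathcomp Require Import ring lra zify.
Set Implicit Arguments. Unset Strict Implicit. Unset Printing Implicit Defensive.
Import Order.TTheory GRing.Theory Num.Theory.
Local Open Scope ring_scope.

(* Encode a signed measure on words as an element of a matrix algebra in which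
   the letters are the "append a bit" operators; the maximal L1 norm of a row is
   submultiplicative. The trace distribution of p is the product over k of
   P + e_k Q, where P is the factor of a fair bit, Q has norm at most 2, and
   p_k = 1/2 + e_k.

   Take e_k = s (-1)^k eps g(k - c) with s = 1 for S and s = -1 for S', where c is
   the middle of the string and g is a window of width sqrt n supported well inside
   it. Shift the window by x, keeping the signs (-1)^k, and let D(x) be the
   difference of the two resulting products, so that D(0) is what has to be
   bounded.
   - g is a Gaussian-like polynomial, so D is smooth in x at scale sqrt n: its
     differences of order r ~ sqrt n are at most 4^-r e^(O(eps r)).
   - Moving the window together with its signs only moves the middle block by x
     through powers of P, so (-1)^x D(x) = P^(a+x) U P^(b-x) for a fixed U. Its
     r-th difference is an r-fold commutator with P = delta + (1 - delta) beta,
     sandwiched between powers of P of order at least r^2. A commutator with P is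
     one with (1 - delta)(beta - 1), which absorbs r factors P: the difference of
     a binomial law, times 1 - delta, has norm at most (r delta)^(-1/2), which is
     at most 1/8. So each commutator contributes a factor at most 1/4.
   - A sequence D such that both D and (-1)^x D have small r-th differences is
     small, because 2 D(x) is the difference of D(x+1) + D(x) and D(x+1) - D(x). *)

(** * Row norm and iterated differences *)

Section RowNorm.
Variables (R : realFieldType) (N : nat).
Implicit Types A B : 'M[R]_N.+1.

Definition row_norm A : R := \big[Num.max/0]_i \sum_j `|A i j|.

Lemma row_norm_ge i A : \sum_j `|A i j| <= row_norm A.
Proof. exact: (le_bigmax 0 (fun i => \sum_j `|A i j|)). Qed.

Lemma row_norm_le c A :
  0 <= c -> (forall i, \sum_j `|A i j| <= c) -> row_norm A <= c.
Proof. by move=> c0 Ac; apply: bigmax_le. Qed.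

Lemma row_norm_ge0 A : 0 <= row_norm A.
Proof. by apply: le_trans (row_norm_ge ord0 A); apply: sumr_ge0. Qed.

Lemma row_normD A B : row_norm (A + B) <= row_norm A + row_norm B.
Proof.
apply: row_norm_le => [|i]; first by rewrite addr_ge0 ?row_norm_ge0.
apply: le_trans (lerD (row_norm_ge i A) (row_norm_ge i B)).
by rewrite -big_split; apply: ler_sum => j _; rewrite mxE ler_normD.
Qed.

Lemma row_normM A B : row_norm (A * B) <= row_norm A * row_norm B.
Proof.
apply: row_norm_le => [|i]; first by rewrite mulr_ge0 ?row_norm_ge0.
apply: (@le_trans _ _ (\sum_j \sum_k `|A i k| * `|B k j|)).
  apply: ler_sum => j _; rewrite -mulmxE mxE.
  by apply: le_trans (ler_norm_sum _ _ _) _; under eq_bigr do rewrite normrM.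
rewrite exchange_big; apply: le_trans (ler_wpM2r (row_norm_ge0 B) (row_norm_ge i A)).
rewrite mulr_suml; apply: ler_sum => k _; rewrite -mulr_sumr.
by rewrite ler_wpM2l ?row_norm_ge.
Qed.

Lemma row_normZ a A : row_norm (a *: A) <= `|a| * row_norm A.
Proof.
apply: row_norm_le => [|i]; first by rewrite mulr_ge0 ?row_norm_ge0.
apply: le_trans (ler_wpM2l (normr_ge0 a) (row_norm_ge i A)).
by rewrite mulr_sumr; apply: ler_sum => j _; rewrite mxE normrM.
Qed.

Lemma row_normN A : row_norm (- A) <= row_norm A.
Proof. by have := row_normZ (-1) A; rewrite normrN1 mul1r scaleN1r. Qed.

Lemma row_normB A B : row_norm (A - B) <= row_norm A + row_norm B.
Proof. by apply: le_trans (row_normD _ _) _; rewrite lerD2l row_normN. Qed.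

Lemma row_norm0 : row_norm 0 <= 0.
Proof.
by apply: row_norm_le => // i; rewrite big1 // => j _; rewrite mxE normr0.
Qed.

Lemma row_norm1 : row_norm 1 <= 1.
Proof.
apply: row_norm_le => // i; rewrite (bigD1 i) //= big1 => [|j /negPf ji].
  by rewrite mxE eqxx normr1 addr0.
by rewrite mxE eq_sym ji normr0.
Qed.

Lemma row_normM_le a b A B : row_norm A <= a -> row_norm B <= b ->
  row_norm (A * B) <= a * b.
Proof.
by move=> Aa Bb; apply: le_trans (row_normM _ _) _; apply: ler_pM; rewrite ?row_norm_ge0.
Qed.

Lemma row_norm_scalar a : row_norm a%:M <= `|a|.
Proof.
rewrite -scalemx1; apply: le_trans (row_normZ _ _) _.
by rewrite ler_piMr // row_norm1.
Qed.

Lemma le_row_norm_scalar a : `|a| <= row_norm a%:M.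
Proof.
apply: le_trans (row_norm_ge ord0 _); rewrite (bigD1 ord0) //= mxE mulr1n lerDl.
exact: sumr_ge0.
Qed.

Lemma row_normX A n : row_norm A <= 1 -> row_norm (A ^+ n) <= 1.
Proof.
move=> A1; elim: n => [|n IH]; first exact: row_norm1.
by rewrite exprS -[leRHS]mulr1 row_normM_le.
Qed.

Lemma row_norm_sum (I : Type) (s : seq I) (F : I -> 'M[R]_N.+1) :
  row_norm (\sum_(i <- s) F i) <= \sum_(i <- s) row_norm (F i).
Proof.
elim: s => [|i s IH]; first by rewrite !big_nil row_norm0.
by rewrite !big_cons; apply: le_trans (row_normD _ _) _; rewrite lerD2l.
Qed.

Lemma row_norm_prod1 (I : eqType) (s : seq I) (F : I -> 'M[R]_N.+1) :
  (forall i, i \in s -> row_norm (F i) <= 1) -> row_norm (\prod_(i <- s) F i) <= 1.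
Proof.
elim: s => [|i s IH] F1; first by rewrite big_nil row_norm1.
rewrite big_cons -[leRHS]mulr1 row_normM_le ?F1 ?mem_head ?IH // => j js.
by apply: F1; rewrite inE js orbT.
Qed.

End RowNorm.

(** * Polynomials with nonnegative coefficients *)

Section NonnegCoef.
Variable R : realFieldType.
Implicit Types p q : {poly R}.

(** For such polynomials one value at a positive point bounds every coefficient. *)
Definition coef_ge0 p := forall i, 0 <= p`_i.

Lemma coef_ge0C c : 0 <= c -> coef_ge0 c%:P.
Proof. by move=> c0 i; rewrite coefC; case: ifP. Qed.

Lemma coef_ge0X : coef_ge0 'X.
Proof. by move=> i; rewrite coefX ler0n. Qed.

Lemma coef_ge0D p q : coef_ge0 p -> coef_ge0 q -> coef_ge0 (p + q).
Proof. by move=> p0 q0 i; rewrite coefD addr_ge0. Qed.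

Lemma coef_ge0M p q : coef_ge0 p -> coef_ge0 q -> coef_ge0 (p * q).
Proof. by move=> p0 q0 i; rewrite coefM sumr_ge0 // => j _; rewrite mulr_ge0. Qed.

Lemma coef_ge0_prod (I : Type) (s : seq I) (F : I -> {poly R}) :
  (forall i, coef_ge0 (F i)) -> coef_ge0 (\prod_(i <- s) F i).
Proof.
move=> F0; elim: s => [|i s IH]; first by rewrite big_nil -polyC1; apply: coef_ge0C.
by rewrite big_cons; apply: coef_ge0M.
Qed.

Lemma coef_ge0_exp p n : coef_ge0 p -> coef_ge0 (p ^+ n).
Proof.
move=> p0; elim: n => [|n IH]; first by rewrite expr0 -polyC1; apply: coef_ge0C.
by rewrite exprS; apply: coef_ge0M.
Qed.

End NonnegCoef.

Section Differences.
Variables (R : realFieldType) (N : nat).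
Local Notation A := 'M[R]_N.+1.
Implicit Types (u v : nat -> A) (p q : {poly R}).

Fixpoint fdiff k v x : A :=
  if k is k'.+1 then fdiff k' v x.+1 - fdiff k' v x else v x.

(** The recursion puts the new difference outermost; the product and sign arguments need it
    innermost. *)
Lemma fdiffSr k v x : fdiff k.+1 v x = fdiff k (fdiff 1 v) x.
Proof. by elim: k x => //= k IH x; rewrite -!IH. Qed.

Lemma fdiff_shift k v x : fdiff k (fun y => v y.+1) x = fdiff k v x.+1.
Proof. by elim: k x => //= k IH x; rewrite !IH. Qed.

Lemma eq_fdiff k u v x : (forall y, (y <= x + k)%N -> u y = v y) ->
  fdiff k u x = fdiff k v x.
Proof.
elim: k x => [|k IH] x uv /=; first by rewrite uv ?addn0.
by rewrite !(IH _) // => y yx; apply: uv; rewrite -?addSnnS // addSn leqW.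
Qed.

Lemma fdiffD k u v x : fdiff k (fun y => u y + v y) x = fdiff k u x + fdiff k v x.
Proof. by elim: k x => //= k IH x; rewrite !IH opprD addrACA. Qed.

(* [p] is an exponential generating function of bounds for the iterated
   differences of [v], so that the Leibniz rule becomes the product of
   polynomials. *)
Definition diff_bound M v p :=
  forall k x, (x + k <= M)%N -> row_norm (fdiff k v x) <= (p^`(k)).[0].

Lemma diff_bound_ext M u v p : (forall y, (y <= M)%N -> u y = v y) ->
  diff_bound M v p -> diff_bound M u p.
Proof.
move=> uv vp k x xk; rewrite (@eq_fdiff _ u v) ?vp // => y yx.
by apply: uv; apply: leq_trans xk.
Qed.

Lemma diff_boundD M u v p q : diff_bound M u p -> diff_bound M v q ->
  diff_bound M (fun x => u x + v x) (p + q).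
Proof.
move=> up vq k x xk; rewrite fdiffD derivnD hornerD.
by apply: le_trans (row_normD _ _) _; apply: lerD; [apply: up | apply: vq].
Qed.

(** Leibniz rule by induction on the order: one difference of the product is [fdiff 1 u] times the
    shifted [v], plus [u] times [fdiff 1 v], matching the derivative of [p * q]. The range drops by
    one to leave room for the shift. *)
Lemma diff_boundM M u v p q : diff_bound M u p -> diff_bound M v q ->
  diff_bound M (fun x => u x * v x) (p * q).
Proof.
move=> up vq k; elim: k M u v p q up vq => [|k IH] M u v p q up vq x xk.
  rewrite derivn0 hornerM; have := vq 0%N x xk; have := up 0%N x xk.
  by rewrite !derivn0; apply: row_normM_le.
case: M up vq xk => [|M] up vq; first by rewrite addnS.
rewrite addnS ltnS => xk; rewrite fdiffSr derivSn derivM derivnD hornerD.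
rewrite (@eq_fdiff _ _ (fun y => fdiff 1 u y * v y.+1 + u y * fdiff 1 v y)); last first.
  by move=> y _ /=; rewrite mulrBl mulrBr addrA subrK.
rewrite fdiffD; apply: le_trans (row_normD _ _) _; apply: lerD; apply: (IH M) => //.
- by move=> j y yj; rewrite -fdiffSr -derivSn; apply: up; rewrite addnS.
- by move=> j y yj; rewrite fdiff_shift; apply: vq.
- by move=> j y yj; apply: up; apply: leqW.
- by move=> j y yj; rewrite -fdiffSr -derivSn; apply: vq; rewrite addnS.
Qed.

Lemma diff_bound_cst M (B : A) c : row_norm B <= c -> diff_bound M (fun=> B) c%:P.
Proof.
move=> Bc [|k] x xk; first by rewrite derivn0 hornerC.
rewrite derivnC horner0.
suff -> : fdiff k.+1 (fun=> B) x = 0 by exact: row_norm0.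
elim: k x {xk} => [|k IH] x; first exact: subrr.
by rewrite -[LHS]/(fdiff k.+1 _ x.+1 - fdiff k.+1 _ x) !IH subrr.
Qed.

(** The value is at most [M], the first difference is 1 and the others vanish. *)
Lemma diff_bound_id M : diff_bound M (fun x => (x%:R)%:M) ((M%:R)%:P + 'X).
Proof.
move=> [|[|k]] x xk.
- rewrite derivn0 !hornerE; apply: le_trans (row_norm_scalar _ _) _.
  by rewrite normr_nat ler_nat -[x]addn0.
- rewrite derivn1 derivD derivC derivX !hornerE /= -raddfB /= -natr1 addrAC subrr add0r.
  exact: row_norm1.
- rewrite fdiffSr derivSn derivD derivC derivX add0r.
  have /(_ k.+1 x) : diff_bound M (fdiff 1 (fun x => (x%:R)%:M)) 1.
    apply: (@diff_bound_ext _ _ (fun=> 1)).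
      by move=> y _ /=; rewrite -raddfB /= -natr1 addrAC subrr add0r.
    by rewrite -polyC1; exact/diff_bound_cst/row_norm1.
  by apply; apply: leq_trans xk; rewrite leq_add2l.
Qed.

Lemma diff_bound_prod (I : Type) (s : seq I) (F : I -> nat -> A) (P : I -> {poly R}) M :
  (forall i, diff_bound M (F i) (P i)) ->
  diff_bound M (fun x => \prod_(i <- s) F i x) (\prod_(i <- s) P i).
Proof.
move=> FP; elim: s => [|i s IH].
  rewrite big_nil; apply: (@diff_bound_ext _ _ (fun=> 1)) => [y _|]; first by rewrite big_nil.
  rewrite -polyC1; exact/diff_bound_cst/row_norm1.
rewrite big_cons; apply: (@diff_bound_ext _ _ (fun x => F i x * \prod_(j <- s) F j x)).
  by move=> y _; rewrite big_cons.
exact: diff_boundM.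
Qed.

(** Cauchy's estimate: the derivative of order [k] at 0 is [k!] times coefficient [k], and that
    coefficient times [t ^+ k] is one of the nonnegative terms of [p.[t]]. *)
Lemma diff_bound_horner M v p k x t : diff_bound M v p -> (x + k <= M)%N ->
  coef_ge0 p -> 0 < t ->
  row_norm (fdiff k v x) <= k`!%:R / t ^+ k * p.[t].
Proof.
move=> vp xk p0 t0; apply: le_trans (vp _ _ xk) _.
rewrite horner_coef0 coef_derivn addn0 ffactnn -[leLHS]mulr_natl -mulrA ler_wpM2l //.
rewrite mulrC ler_pdivlMr ?exprn_gt0 //.
have [kp|pk] := ltnP k (size p); last first.
  rewrite (nth_default _ pk) mul0r horner_coef sumr_ge0 // => i _.
  by rewrite mulr_ge0 ?p0 // exprn_ge0 // ltW.
rewrite horner_coef (bigD1 (Ordinal kp)) //= lerDl.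
by apply: sumr_ge0 => i _; rewrite mulr_ge0 ?p0 // exprn_ge0 // ltW.
Qed.

Lemma fdiffN k v x : fdiff k (fun y => - v y) x = - fdiff k v x.
Proof. by elim: k x => //= k IH x; rewrite !IH opprB opprK addrC. Qed.

Lemma fdiff_sign v x :
  fdiff 1 (fun y => (-1) ^+ y *: v y) x = - ((-1) ^+ x *: (v x.+1 + v x)).
Proof. by rewrite /= exprS mulN1r scaleNr scalerDr opprD. Qed.

(* The sum and difference of [d x.+1] and [d x] cannot both be small. *)
Lemma row_norm_alternating M a b (d : nat -> A) (e1 e2 : R) :
  (a + b <= M)%N -> 0 <= e1 -> 0 <= e2 ->
  (forall x, (x + a <= M)%N -> row_norm (fdiff a d x) <= e1) ->
  (forall x, (x + b <= M)%N -> row_norm (fdiff b (fun y => (-1) ^+ y *: d y) x) <= e2) ->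
  row_norm (d 0%N) <= 2 ^+ b * e1 + 2 ^+ a * e2.
Proof.
elim: a b M d e1 e2 => [|a IHa] b M d e1 e2 abM e1_ge0 e2_ge0.
  move=> /(_ 0%N isT) /= d1 _; apply: le_trans d1 _; rewrite mul1r -[leLHS]addr0 lerD //.
  by rewrite ler_peMl // exprn_ege1 ?ler1n.
elim: b M d e1 e2 abM e1_ge0 e2_ge0 => [|b IHb] M d e1 e2 abM e1_ge0 e2_ge0.
  move=> _ /(_ 0%N isT) /=; rewrite scale1r => d2; apply: le_trans d2 _.
  rewrite mul1r -[leLHS]add0r lerD // ler_peMl // exprn_ege1 ?ler1n //.
case: M abM => [|M] abM d1 d2; first by rewrite addSn in abM.
(* Passing to the sums [d y.+1 + d y] doubles [e1] but saves one order in the signed bound. *)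
have d'1 x : (x + a.+1 <= M)%N -> row_norm (fdiff a.+1 (fun y => d y.+1 + d y) x) <= 2 * e1.
  move=> xa; rewrite fdiffD fdiff_shift mulr_natl mulr2n.
  by apply: le_trans (row_normD _ _) (lerD _ _); apply: d1 => //; apply: leqW.
have d'2 x : (x + b <= M)%N ->
    row_norm (fdiff b (fun y => (-1) ^+ y *: (d y.+1 + d y)) x) <= e2.
  move=> xb; rewrite -[fdiff _ _ _]opprK -fdiffN.
  rewrite (@eq_fdiff _ _ (fdiff 1 (fun y => (-1) ^+ y *: d y))).
    by rewrite -fdiffSr; apply: le_trans (row_normN _) _; apply: d2; rewrite addnS.
  by move=> y _; rewrite fdiff_sign.
(* Passing to the differences does the opposite: it saves one unsigned order and doubles [e2]. *)
have d''1 x : (x + a <= M)%N -> row_norm (fdiff a (fdiff 1 d) x) <= e1.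
  by move=> xa; rewrite -fdiffSr; apply: d1; rewrite addnS.
have d''2 x : (x + b.+1 <= M)%N ->
    row_norm (fdiff b.+1 (fun y => (-1) ^+ y *: fdiff 1 d y) x) <= 2 * e2.
  move=> xb; set e := fun y => (-1) ^+ y *: d y.
  rewrite (@eq_fdiff _ _ (fun y => - (e y.+1 + e y))); last first.
    by move=> y _; rewrite /e /= exprS mulN1r scaleNr scalerBr opprD opprK.
  rewrite fdiffN fdiffD fdiff_shift; apply: le_trans (row_normN _) _.
  rewrite mulr_natl mulr2n.
  by apply: le_trans (row_normD _ _) (lerD _ _); apply: d2 => //; apply: leqW.
have abM' : (a.+1 + b <= M)%N by rewrite addnS ltnS in abM.
have abM'' : (a + b.+1 <= M)%N by rewrite addSn ltnS in abM.
have h1 := IHb M _ _ _ abM' (mulr_ge0 (ler0n _ 2) e1_ge0) e2_ge0 d'1 d'2.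
have h2 := IHa b.+1 M _ _ _ abM'' e1_ge0 (mulr_ge0 (ler0n _ 2) e2_ge0) d''1 d''2.
have -> : d 0%N = 2^-1 *: ((d 1%N + d 0%N) - fdiff 1 d 0%N).
  rewrite /= opprB [d 0%N - _]addrC addrACA subrr add0r -[in RHS]mulr2n -scaler_nat.
  rewrite scalerA mulVf ?scale1r //.
  by rewrite pnatr_eq0.
apply: le_trans (row_normZ _ _) _; rewrite ger0_norm ?invr_ge0 ?ler0n //.
rewrite ler_pdivrMl ?ltr0n //; apply: le_trans (row_normB _ _) _.
apply: le_trans (lerD h1 h2) _; rewrite !exprS; lra.
Qed.

End Differences.

(** * Smoothing by random deletions *)

Section Smoothing.
Variables (R : realFieldType) (N : nat).
Local Notation A := 'M[R]_N.+1.

Lemma row_norm_horner_mx (B : A) (p : {poly R}) : row_norm B <= 1 ->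
  row_norm (horner_mx B p) <= \sum_(i < size p) `|p`_i|.
Proof.
move=> B1; rewrite -[p in horner_mx _ p]coefK poly_def linear_sum.
apply: le_trans (row_norm_sum _ _) _; apply: ler_sum => i _.
rewrite linearZ rmorphXn /= horner_mx_X.
by apply: le_trans (row_normZ _ _) _; rewrite ler_piMr // row_normX.
Qed.

Lemma sum_coef_wide m (p : {poly R}) : (size p <= m)%N ->
  \sum_(i < m) p`_i = p.[1].
Proof.
by move=> pm; rewrite (horner_coef_wide _ pm); apply: eq_bigr => i _; rewrite expr1n mulr1.
Qed.

Lemma coef_Xderiv (p : {poly R}) i : ('X * p^`())`_i = i%:R * p`_i.
Proof. by rewrite coefXM coef_deriv; case: i => [|i]; rewrite ?mul0r ?mulr_natl. Qed.

Lemma size_Xderiv (p : {poly R}) : (size ('X * p^`())%R <= size p)%N.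
Proof.
apply/leq_sizeP => i pi; rewrite coef_Xderiv nth_default ?mulr0 //.
Qed.

(** For [d] in [0, 1], [P] generates a binomial law. Differentiating and multiplying by ['X] weights
    coefficient [i] by [i], so moments are values at 1. *)
Lemma binomial_variance (d : R) n (P := (d%:P + (1 - d) *: 'X) ^+ n) :
  \sum_(i < size P) (i%:R - n%:R * (1 - d)) ^+ 2 * P`_i = n%:R * (1 - d) * d.
Proof.
set y := n%:R * (1 - d).
have moments : \sum_(i < size P) (i%:R - y) ^+ 2 * P`_i =
    ('X * ('X * P^`())^`()).[1] - 2 * y * ('X * P^`()).[1] + y ^+ 2 * P.[1].
  rewrite -!(@sum_coef_wide (size P)) //; last 2 first.
  - exact: size_Xderiv.
  - exact: leq_trans (size_Xderiv _) (size_Xderiv _).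
  rewrite !mulr_sumr -sumrB -big_split; apply: eq_bigr => i _.
  by rewrite /= !coef_Xderiv; ring.
rewrite {}moments /P; set B := d%:P + _.
have B1 : B.[1] = 1 by rewrite /B !hornerE /=; ring.
have B' : B^`() = (1 - d)%:P.
  by rewrite /B derivD derivC derivZ derivX add0r alg_polyC.
have P'1 k : ((B ^+ k)^`()).[1] = k%:R * (1 - d).
  by rewrite deriv_exp B' hornerMn hornerM horner_exp B1 expr1n hornerC mulr1 mulr_natl.
have P''1 : ((B ^+ n)^`()^`()).[1] = n%:R * (n%:R - 1) * (1 - d) ^+ 2.
  rewrite deriv_exp B' derivMn derivM derivC mul0r add0r hornerMn hornerM P'1 hornerC.
  case: (n) => [|k]; first by rewrite mulr0n mul0r mul0r.
  rewrite /= -mulr_natl -natr1; ring.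
rewrite derivM derivX mul1r !hornerM hornerD hornerM hornerX P'1 P''1 horner_exp B1 expr1n.
rewrite /y; ring.
Qed.

(** The norm is at most the mean absolute deviation of a binomial law with [n.+1] trials divided by
    [n.+1%:R * d]; the variance controls this deviation. *)
Lemma row_norm_smoothing (B : A) (d : R) n : row_norm B <= 1 -> 0 < d -> d <= 1 ->
  64 <= n.+1%:R * d ->
  row_norm ((d%:M + (1 - d) *: B) ^+ n * ((1 - d) *: (B - 1))) <= 8^-1.
Proof.
move=> B1 d0 d1 nd; set b : {poly R} := d%:P + (1 - d) *: 'X.
set m : R := n.+1%:R in nd *; have m0 : 0 < m by rewrite ltr0n.
(* Coefficient [i] of [W] is a binomial probability times its deviation [i%:R - m * (1 - d)], while
   [W] is also [m * d] times the polynomial to be bounded. *)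
set W : {poly R} := 'X * (b ^+ n.+1)^`() - (m * (1 - d)) *: b ^+ n.+1.
have WE : W = (m * d) *: (b ^+ n * ((1 - d) *: ('X - 1))).
  have b' : b^`() = (1 - d)%:P.
    by rewrite /b derivD derivC derivZ derivX add0r alg_polyC.
  rewrite /W deriv_exp b' -[_ *+ n.+1]mulr_natl -polyC_natr -/m /= exprS -!mul_polyC /b.
  rewrite -!mul_polyC !(polyCM, polyCB, polyCD); ring.
have hb : horner_mx B b = d%:M + (1 - d) *: B.
  by rewrite /b rmorphD /= horner_mx_C linearZ /= horner_mx_X.
have hW : horner_mx B W = (m * d) *: ((d%:M + (1 - d) *: B) ^+ n * ((1 - d) *: (B - 1))).
  rewrite WE linearZ rmorphM rmorphXn /= hb linearZ /= rmorphB /= horner_mx_X.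
  by rewrite -polyC1 horner_mx_C.
have md0 : 0 < m * d by rewrite mulr_gt0.
rewrite -[X in row_norm X](@scalerK _ _ (m * d)) ?unitfE ?gt_eqF // -hW.
apply: le_trans (row_normZ _ _) _; rewrite ger0_norm; last by rewrite invr_ge0 ltW.
rewrite ler_pdivrMl //.
apply: le_trans (row_norm_horner_mx _ B1) _.
have b0 : coef_ge0 (b ^+ n.+1).
  apply: coef_ge0_exp; rewrite /b -mul_polyC; apply: coef_ge0D.
    exact/coef_ge0C/ltW.
  by apply: coef_ge0M; [apply: coef_ge0C; rewrite subr_ge0 | apply: coef_ge0X].
have Wi i : W`_i = (i%:R - m * (1 - d)) * (b ^+ n.+1)`_i.
  by rewrite /W coefB coef_Xderiv coefZ mulrBl.
have sW : (size W <= size (b ^+ n.+1))%N.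
  by apply/leq_sizeP => i bi; rewrite Wi nth_default ?mulr0.
have -> : \sum_(i < size W) `|W`_i| = \sum_(i < size (b ^+ n.+1)) `|W`_i|.
  rewrite (big_ord_widen _ (fun i => `|W`_i|) sW) big_mkcond; apply: eq_bigr => i _.
  by case: ltnP => // Wi0; rewrite nth_default ?normr0.
(* AM-GM with weight [z / 8], where [z = m d] dominates the variance *)
set z := m * d in nd md0 *; set th := z / 8.
have th0 : 0 < th by rewrite /th; lra.
apply: (@le_trans _ _ (\sum_(i < size (b ^+ n.+1))
    2^-1 * (th^-1 * ((i%:R - m * (1 - d)) ^+ 2 * (b ^+ n.+1)`_i) + th * (b ^+ n.+1)`_i))).
  apply: ler_sum => i _; rewrite Wi normrM [X in _ * X]ger0_norm //.
  rewrite [th^-1 * _]mulrA -mulrDl mulrA ler_wpM2r //.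
  set y := _ - _; rewrite -[y ^+ 2](real_normK (num_real y)).
  have := sqr_ge0 (`|y| - th); have := normr_ge0 y; move: `|y| => {}y y0 yth.
  rewrite -subr_ge0.
  have -> : 2^-1 * (th^-1 * y ^+ 2 + th) - y = 2^-1 * th^-1 * (y - th) ^+ 2.
    by field; rewrite gt_eqF.
  by rewrite mulr_ge0 // mulr_ge0 ?invr_ge0 // ltW.
rewrite -mulr_sumr big_split -!mulr_sumr /= binomial_variance -/m.
rewrite sum_coef_wide // horner_exp.
have -> : b.[1] = 1 by rewrite /b !hornerE /=; ring.
rewrite expr1n mulr1.
have -> : m * (1 - d) * d = z * (1 - d) by rewrite /z; ring.
have -> : th^-1 * (z * (1 - d)) = 8 * (1 - d).
  by rewrite /th; field; rewrite gt_eqF.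
rewrite /th; lra.
Qed.

Fixpoint iter_comm (P U : A) k : A :=
  if k is k'.+1 then P * iter_comm P U k' - iter_comm P U k' * P else U.

(** A step in [x] carries one [P] from the right of [U] to its left, so a difference is a
    commutator. The bound on [x + k] keeps the truncated exponents exact. *)
Lemma fdiff_sandwich (P U : A) a b k x : (x + k <= b)%N ->
  fdiff k (fun x => P ^+ (a + x) * U * P ^+ (b - x)) x =
  P ^+ (a + x) * iter_comm P U k * P ^+ (b - x - k).
Proof.
elim: k x => [|k IH] x xk /=; first by rewrite subn0.
have xk' : (x.+1 + k <= b)%N by rewrite addSnnS.
rewrite !IH //; last by apply: ltnW; rewrite -addnS.
have -> : (b - x.+1 - k = b - x - k.+1)%N by lia.
have -> : (b - x - k = (b - x - k.+1).+1)%N by lia.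
by rewrite addnS exprSr exprS mulrBr mulrBl !mulrA.
Qed.

(** Commutators with [P] are commutators with [G]. In each of the two terms, [G] absorbs [r] powers
    of [P] on its own side and gains [rho]; the [r] powers on the other side have norm at most 1. *)
Lemma row_norm_iter_comm (P G U : A) (rho : R) r k y z :
  (forall V, P * V - V * P = G * V - V * G) -> GRing.comm P G ->
  row_norm P <= 1 -> row_norm (P ^+ r * G) <= rho ->
  row_norm (P ^+ (k * r + y) * iter_comm P U k * P ^+ (k * r + z)) <=
    (2 * rho) ^+ k * row_norm U.
Proof.
move=> PG PGc P1 rhoP; have rho0 := le_trans (row_norm_ge0 _) rhoP.
elim: k => [|k IH].
  rewrite !mul0n !add0n mul1r /= -[leRHS]mulr1 -[X in _ <= X * _]mul1r.
  by do 2 rewrite row_normM_le ?row_normX //.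
rewrite /= PG; set V := iter_comm P U k in IH *.
rewrite !mulSn -!addnA; set s := (k * r + y)%N in IH *; set w := (k * r + z)%N in IH *.
have Gs t : P ^+ t * G = G * P ^+ t by symmetry; exact: (commrX t (commr_sym PGc)).
have -> : P ^+ (r + s) * (G * V - V * G) * P ^+ (r + w) =
    (P ^+ r * G) * (P ^+ s * V * P ^+ w) * P ^+ r
    - P ^+ r * (P ^+ s * V * P ^+ w) * (P ^+ r * G).
  have GA X t : X * G * P ^+ t = X * P ^+ t * G by rewrite -!mulrA Gs.
  by rewrite mulrBr mulrBl [(r + w)%N]addnC !exprD !mulrA !GA.
have Pr1 := row_normX r P1.
apply: le_trans (row_normB _ _) _.
apply: le_trans (lerD (row_normM_le (row_normM_le rhoP IH) Pr1)
  (row_normM_le (row_normM_le Pr1 IH) rhoP)) _.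
by rewrite le_eqVlt; apply/orP; left; apply/eqP; rewrite exprS; ring.
Qed.

End Smoothing.

(** * Traces as matrix products *)

Section TraceMatrix.
Variables (R : realType) (N : nat).

(* A binary word is coded by the integer whose binary expansion is a leading 1
   followed by the word, so that appending [b] maps the code [c] to [2c + b]. *)
Definition word_code (w : seq bool) : nat := foldl (fun c (b : bool) => c.*2 + b)%N 1%N w.

(** Acts on row vectors indexed by codes; a row whose new code would exceed [N] is zero. *)
Definition append_mx (b : bool) : 'M[R]_N.+1 :=
  \matrix_(i, j) (nat_of_ord j == i.*2 + b)%N%:R.

Lemma word_code_rcons w b : word_code (rcons w b) = ((word_code w).*2 + b)%N.
Proof. by rewrite /word_code foldl_rcons. Qed.

Lemma word_code_gt0 w : (0 < word_code w)%N.
Proof. by elim/last_ind: w => // w b IH; rewrite word_code_rcons; lia. Qed.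

Lemma word_code_lt w : (word_code w < 2 ^ (size w).+1)%N.
Proof.
elim/last_ind: w => // w b IH; rewrite word_code_rcons size_rcons expnS.
by case: b; lia.
Qed.

Lemma word_code_inj : injective word_code.
Proof.
elim/last_ind=> [|w b IH] w'.
  elim/last_ind: w' => // w' b' _; rewrite word_code_rcons => /= e.
  by have := word_code_gt0 w'; move: e; rewrite /word_code /=; lia.
elim/last_ind: w' => [|w' b' _]; rewrite !word_code_rcons.
  by have := word_code_gt0 w; rewrite /word_code /=; lia.
move=> e; have bb' : b = b' by move: e; case: b b' => [] [] /= e //; exfalso; lia.
by rewrite bb' (IH w') //; move: e; rewrite bb'; lia.
Qed.

Lemma row_norm_append_mx b : row_norm (append_mx b) <= 1.
Proof.
apply: row_norm_le => // i.
have [lt|ge] := ltnP (i.*2 + b)%N N.+1; last first.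
  rewrite big1 // => j _; rewrite mxE; case: eqP => [e|]; rewrite ?normr0 //.
  by have := ltn_ord j; lia.
rewrite (bigD1 (Ordinal lt)) //= big1 => [|j ji]; first by rewrite mxE /= eqxx normr1 addr0.
by rewrite mxE; case: eqP => [e|]; rewrite ?normr0 //; case/eqP: ji; apply/val_inj.
Qed.

(** Row [inord 1] stands for the empty word; the size condition keeps all intermediate codes in
    range. *)
Lemma append_mx_prod w j : (2 ^ (size w).+1 <= N.+1)%N ->
  (\prod_(b <- w) append_mx b) (inord 1) j = (nat_of_ord j == word_code w)%:R.
Proof.
elim/last_ind: w j => [|w b IH] j.
  rewrite big_nil mxE eq_sym -val_eqE /= => N2; rewrite inordK //.
rewrite size_rcons expnS word_code_rcons => Nw.
rewrite -cats1 big_cat big_seq1 /= -mulmxE mxE.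
have wN : (word_code w < N.+1)%N by have := word_code_lt w; lia.
rewrite (bigD1 (Ordinal wN)) //= big1 => [|k kw]; last first.
  rewrite IH; last by lia.
  by case: eqP => [e|]; rewrite ?mul0r //; case/eqP: kw; apply/val_inj.
by rewrite addr0 IH; [rewrite eqxx mul1r mxE | lia].
Qed.

Section Traces.
Variables (n : nat) (d : R).

Definition bit_mx (a : R) : 'M[R]_N.+1 :=
  d%:M + (1 - d) *: (a *: append_mx true + (1 - a) *: append_mx false).

Lemma bit_prod (p : 'I_n -> R) :
  \prod_(i < n) bit_mx (p i) =
  \sum_(T : {ffun 'I_n -> bool}) \sum_(K : {set 'I_n})
    (pr_string p T * pr_keep d K) *: \prod_(b <- surviving T K) append_mx b.
Proof.
have bit_split a : bit_mx a =
    \sum_(b : bool) (if b then a else 1 - a) *: ((1 - d) *: append_mx b + d *: 1).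
  rewrite /bit_mx big_bool /= -scalemx1; apply/matrixP => i j.
  rewrite -[1 : 'M[R]_N.+1]/(1%:M).
  move: (append_mx true) (append_mx false) (1%:M) => S1 S0 I.
  by rewrite !mxE; ring.
under eq_bigr do rewrite bit_split.
rewrite bigA_distr_bigA /=; apply: eq_bigr => T _.
rewrite scaler_prod -/(pr_string p T) bigA_distr scaler_sumr; apply: eq_bigr => K _.
rewrite -scalerA; congr (_ *: _).
(* [enum K] is increasing, so the ordered product over the survivors is the product over all indices
   with 1 at the deleted ones. *)
rewrite /surviving big_map /enum_mem big_filter.
have -> : \prod_i (if i \in K then (1 - d) *: append_mx (T i) else d *: 1) =
  \prod_i ((if i \in K then 1 - d else d) *: (if i \in K then append_mx (T i) else 1)).
  by apply: eq_bigr => i _; case: ifP.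
rewrite scaler_prod -/(pr_keep d K); congr (_ *: _).
by rewrite -big_mkcond /index_enum; case: index_enum_key.
Qed.

Lemma trace_prob_mx (p : 'I_n -> R) w :
  (2 ^ n.+1 <= N.+1)%N -> (size w <= n)%N ->
  (\prod_(i < n) bit_mx (p i)) (inord 1) (inord (word_code w)) = trace_prob p d w.
Proof.
move=> Nn wn; rewrite bit_prod summxE; apply: eq_bigr => T _.
rewrite summxE; apply: eq_bigr => K _; rewrite mxE append_mx_prod.
  rewrite inordK; last first.
    apply: leq_trans Nn; apply: leq_trans (word_code_lt w) _.
    by rewrite leq_pexp2l.
  rewrite (inj_eq word_code_inj) eq_sym; case: eqP => _; by rewrite ?mulr1 ?mulr0.
apply: leq_trans Nn; rewrite leq_pexp2l // ltnS size_map -cardE.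
by apply: leq_trans (max_card _) _; rewrite card_ord.
Qed.

(** Words of length at most [n] have distinct codes in range, so the sum is part of the L1 norm of
    one row, that of the empty word. *)
Lemma trace_tv_le (p p' : 'I_n -> R) : (2 ^ n.+1 <= N.+1)%N ->
  trace_tv p p' d <=
  2^-1 * row_norm (\prod_(i < n) bit_mx (p i) - \prod_(i < n) bit_mx (p' i)).
Proof.
move=> Nn; rewrite /trace_tv ler_wpM2l ?invr_ge0 //.
set D := _ - _; apply: le_trans (row_norm_ge (inord 1) D).
(* Pairing a word with its length turns the double sum into one over a single finite type. *)
pose code (s : {k : 'I_n.+1 & k.-tuple bool}) : 'I_N.+1 := inord (word_code (tagged s)).
have codeE s : val (code s) = word_code (tagged s).
  rewrite /code /= inordK //; apply: leq_trans Nn; apply: leq_trans (word_code_lt _) _.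
  by rewrite leq_pexp2l // size_tuple.
have code_inj : injective code.
  move=> [k w] [k' w'] /(congr1 val); rewrite !codeE => /word_code_inj /= ww'.
  have kk' : k = k' by apply/val_inj; rewrite /= -(size_tuple w) ww' size_tuple.
  by case: k' / kk' w' ww' => w' /val_inj ->.
rewrite (eq_bigr (fun k : 'I_n.+1 => \sum_(w : k.-tuple bool | xpredT w)
   `|D (inord 1) (code (Tagged (fun k : 'I_n.+1 => k.-tuple bool) w))|)); last first.
  move=> k _; apply: eq_bigr => w _.
  rewrite /D !mxE !trace_prob_mx // size_tuple -ltnS //.
rewrite (sig_big_dep (fun _ => true) (fun _ _ => true)
  (fun (k : 'I_n.+1) (w : k.-tuple bool) =>
   `|D (inord 1) (code (Tagged (fun k : 'I_n.+1 => k.-tuple bool) w))|)) /=.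
rewrite [leRHS](bigID (mem [set code s | s in setT])) /= big_imset; last first.
  by move=> x y _ _; apply: code_inj.
rewrite -[leLHS]addr0 lerD ?sumr_ge0 //.
by rewrite le_eqVlt; apply/orP; left; apply/eqP; apply: eq_big => [s|[k w] _]; rewrite ?inE.
Qed.

End Traces.

End TraceMatrix.

(** * The window *)

Section Window.
Variables (R : realType) (h : nat).
Implicit Types y i s t : R.

Let J (j : 'I_h) : R := (h + j.+1)%:R.

(* A discrete Gaussian of variance about [h] which vanishes at the integers of
   absolute value in (h, 2h], so that no cutoff is needed there. *)
Definition window y : R := \prod_(j < h) (1 - y ^+ 2 / J j ^+ 2).

Lemma Jgt0 j : 0 < J j. Proof. by rewrite ltr0n addnS. Qed.

Lemma Jge0 j : 0 <= J j. Proof. exact/ltW/Jgt0. Qed.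

Lemma Jgeh j : h%:R <= J j. Proof. by rewrite ler_nat leq_addr. Qed.

Lemma Jle2h j : J j <= 2 * h%:R.
Proof. by rewrite -natrM ler_nat mul2n -addnn leq_add2l. Qed.

Lemma windowN y : window (- y) = window y.
Proof. by rewrite /window; under eq_bigr do rewrite sqrrN. Qed.

Lemma window_nat_eq0 u : (h < u <= h.*2)%N -> window u%:R = 0.
Proof.
move=> /andP[hu u2h].
have uh : ((u - h).-1 < h)%N by lia.
rewrite /window (bigD1 (Ordinal uh)) //= /J /=.
have -> : (h + (u - h).-1.+1 = u)%N by lia.
by rewrite divff ?subrr ?mul0r // expf_neq0 // pnatr_eq0; lia.
Qed.

(** One disjunct for each side of the centre, as natural subtraction truncates at 0. *)
Lemma window_eq0 (a b : nat) : (h < a - b <= h.*2)%N || (h < b - a <= h.*2)%N ->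
  window (a%:R - b%:R) = 0.
Proof.
case/orP=> ab; last rewrite -windowN opprB; rewrite -natrB ?window_nat_eq0 //; lia.
Qed.

Lemma window_factor y j : `|y| <= h%:R -> 0 <= y ^+ 2 / J j ^+ 2 <= 1.
Proof.
move=> yh; rewrite divr_ge0 ?sqr_ge0 //= ler_pdivrMr ?exprn_gt0 ?Jgt0 // mul1r.
by rewrite -[y ^+ 2]real_normK ?num_real // lerXn2r ?nnegrE ?Jge0 // (le_trans yh) ?Jgeh.
Qed.

Lemma window_ge0 y : `|y| <= h%:R -> 0 <= window y.
Proof.
by move=> yh; apply: prodr_ge0 => j _; have /andP[] := window_factor j yh; rewrite subr_ge0.
Qed.

(** Weierstrass' inequality: the product is at least 1 minus the sum of [h] terms, each at most
    [y ^+ 2 / h%:R ^+ 2]. *)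
Lemma window_ge y : `|y| <= h%:R -> (0 < h)%N -> 1 - y ^+ 2 / h%:R <= window y.
Proof.
move=> yh h0; have hR : 0 < h%:R :> R by rewrite ltr0n.
apply: (@le_trans _ _ (1 - \sum_(j < h) y ^+ 2 / J j ^+ 2)).
  rewrite lerD2l lerN2; apply: (@le_trans _ _ (\sum_(j < h) y ^+ 2 / h%:R ^+ 2)).
    apply: ler_sum => j _; rewrite ler_wpM2l ?sqr_ge0 //.
    by rewrite lef_pV2 ?posrE ?exprn_gt0 ?Jgt0 // lerXn2r ?nnegrE ?Jge0 ?Jgeh.
  rewrite sumr_const card_ord -mulr_natl le_eqVlt; apply/orP; left; apply/eqP.
  by field; rewrite gt_eqF.
rewrite /window; suff [] : 0 <= \sum_(j < h) y ^+ 2 / J j ^+ 2 /\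
  1 - \sum_(j < h) y ^+ 2 / J j ^+ 2 <= \prod_(j < h) (1 - y ^+ 2 / J j ^+ 2) by [].
elim/big_rec2: _ => [|j a b _ [b0 ab]]; first by split; rewrite ?subr0.
have /andP[] := window_factor j yh; set z := _ / _ => z0 z1; split; first exact: addr_ge0.
have := mulr_ge0 z0 b0; have : 0 <= (1 - z) * (a - (1 - b)) by rewrite mulr_ge0; lra.
lra.
Qed.

Lemma window_le1 y : `|y| <= h%:R -> window y <= 1.
Proof.
move=> yh; apply: prodr_ile1 => j _.
by have /andP[] := window_factor j yh; lra.
Qed.

(** Each factor of [window (y - x%:R)] is expanded in powers of [x]; coefficients become absolute
    values and [x] becomes its bound from [diff_bound_id]. *)
Definition window_poly (M : nat) y : {poly R} := \prod_(j < h)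
  (`|1 - y ^+ 2 / J j ^+ 2|%:P + (2 * `|y| / J j ^+ 2)%:P * ((M%:R)%:P + 'X)
   + (J j ^- 2)%:P * (((M%:R)%:P + 'X) * ((M%:R)%:P + 'X))).

Lemma window_poly_ge0 M y : coef_ge0 (window_poly M y).
Proof.
have MX : coef_ge0 ((M%:R)%:P + 'X : {poly R}).
  by apply: coef_ge0D; [apply: coef_ge0C | apply: coef_ge0X].
apply: coef_ge0_prod => j; have J2 : 0 <= J j ^- 2 by rewrite invr_ge0 sqr_ge0.
apply: coef_ge0D; first apply: coef_ge0D.
- exact: coef_ge0C.
- by apply: coef_ge0M => //; apply: coef_ge0C; rewrite !mulr_ge0.
- by apply: coef_ge0M; [apply: coef_ge0C | apply: coef_ge0M].
Qed.

Lemma window_diff_bound N M y :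
  diff_bound M (fun x => (window (y - x%:R))%:M : 'M[R]_N.+1) (window_poly M y).
Proof.
pose F (j : 'I_h) x : 'M[R]_N.+1 := (1 - y ^+ 2 / J j ^+ 2)%:M
  + (2 * y / J j ^+ 2)%:M * (x%:R)%:M + (- J j ^- 2)%:M * ((x%:R)%:M * (x%:R)%:M).
apply: (@diff_bound_ext _ _ _ _ (fun x => \prod_(j < h) F j x)).
  move=> x _; rewrite /window rmorph_prod; apply: eq_bigr => j _.
  rewrite /F -!mulmxE -!scalar_mxM -!raddfD /=; congr (_%:M); ring.
apply: diff_bound_prod => j; apply: diff_boundD; first apply: diff_boundD.
- exact/diff_bound_cst/row_norm_scalar.
- apply: diff_boundM (@diff_bound_id _ _ _); apply: diff_bound_cst.
  apply: le_trans (row_norm_scalar _ _) _.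
  by rewrite !normrM normr_nat [`|_^-1|]ger0_norm // invr_ge0 sqr_ge0.
- apply: diff_boundM (diff_boundM (@diff_bound_id _ _ _) (@diff_bound_id _ _ _)).
  apply: diff_bound_cst; apply: le_trans (row_norm_scalar _ _) _.
  by rewrite normrN ger0_norm // invr_ge0 sqr_ge0.
Qed.

(** The bound for the shift becomes [2 r + 4 r = 6 r]. Each factor is at most [expR e]; the
    resulting Gaussian is weakened to a rational function, whose sum over positions is
    elementary. *)
Lemma window_poly_horner r y : (0 < r)%N -> (64 * r ^ 2 <= h)%N ->
  `|y| <= h%:R + 2 * r%:R ->
  (window_poly (2 * r) y).[4 * r%:R] <= expR 4 / (1 + y ^+ 2 / (8 * h%:R)).
Proof.
move=> r0 rh yM; have h0 : (0 < h)%N by apply: leq_trans rh; rewrite muln_gt0 expn_gt0 r0.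
have hR : 0 < h%:R :> R by rewrite ltr0n.
have {}rh : 64 * r%:R ^+ 2 <= h%:R :> R by rewrite -natrX -natrM ler_nat.
have {r0} rR : 0 < r%:R :> R by rewrite ltr0n.
have yy : y ^+ 2 = `|y| ^+ 2 by rewrite real_normK ?num_real.
set a := `|y| in yM yy *; have a0 : 0 <= a by apply: normr_ge0.
set q : R := r%:R in rh rR yM *; set H : R := h%:R in rh hR yM *.
set e : R := 236 * q ^+ 2 / H ^+ 2 - a ^+ 2 / (8 * H ^+ 2).
rewrite /window_poly horner_prod; apply: (@le_trans _ _ (\prod_(j < h) expR e)).
  apply: ler_prod => j _; apply/andP; split.
    rewrite !hornerE /= !(addr_ge0, mulr_ge0) //; (try exact: ltW); by rewrite invr_ge0 sqr_ge0.
  apply: le_trans (expR_ge1Dx e).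
  rewrite !hornerE /= natrM -/q yy.
  have := Jgt0 j; have := Jgeh j; have := Jle2h j; rewrite -/H; move: (J j) => z z2 z1 z0.
  have zz : 0 < z ^+ 2 by rewrite exprn_gt0.
  (* [a] exceeds [z] by at most [2 * q], so [a ^+ 2 - z ^+ 2] is at most [4 * q * a]; removing the
     absolute value costs twice that. *)
  have h1 : `|1 - a ^+ 2 / z ^+ 2| <= 1 - a ^+ 2 / z ^+ 2 + 4 * a * (2 * q) / z ^+ 2.
    have -> : 1 - a ^+ 2 / z ^+ 2 = (z ^+ 2 - a ^+ 2) / z ^+ 2 by field; rewrite gt_eqF.
    rewrite normrM [`|_^-1|]ger0_norm ?invr_ge0 ?(ltW zz) // -mulrDl.
    rewrite ler_wpM2r ?invr_ge0 ?(ltW zz) //.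
    have az : (a - z) * (a + z) <= 2 * q * (2 * a).
      have [za|za] := lerP a z; last by apply: ler_pM; lra.
      have : 0 <= (z - a) * (a + z) by rewrite mulr_ge0; lra.
      have : 0 <= q * a by rewrite mulr_ge0 // ltW.
      lra.
    have qa : 0 <= q * a by rewrite mulr_ge0 // ltW.
    by rewrite ler_norml; apply/andP; split; lra.
  have h2 : - (a ^+ 2 / 2) / z ^+ 2 <= - (a ^+ 2 / (8 * H ^+ 2)).
    rewrite mulNr lerN2 -[_ / _ / _]mulrA -invfM ler_wpM2l ?sqr_ge0 // lef_pV2 ?posrE; nra.
  have h3 : 236 * q ^+ 2 / z ^+ 2 <= 236 * q ^+ 2 / H ^+ 2.
    by rewrite ler_wpM2l ?lef_pV2 ?posrE; nra.
  (* The cross terms add up to [20 a q], at most [a^2 / 2 + 200 q^2]; with the 36 from the last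
     square this makes 236. *)
  have h4 : (- a ^+ 2 + 4 * a * (2 * q) + 2 * a * (6 * q) + (6 * q) ^+ 2) / z ^+ 2
      <= (- (a ^+ 2 / 2) + 236 * q ^+ 2) / z ^+ 2.
    rewrite ler_wpM2r ?invr_ge0 ?(ltW zz) //; have := sqr_ge0 (a - 20 * q); nra.
  rewrite /e; apply: (@le_trans _ _ (1 + (- (a ^+ 2 / 2) + 236 * q ^+ 2) / z ^+ 2)); last first.
    by rewrite [(_ + _) / _]mulrDl; lra.
  have -> : 2 * q + 4 * q = 6 * q by ring.
  by move: h1 h4; rewrite -/a; move: `|1 - _| => b h1 h4; lra.
rewrite prodr_const card_ord -expRM_natl.
(* Since [64 q^2 <= H], the term [236 q^2 / H] is below 4. *)
apply: (@le_trans _ _ (expR (4 - y ^+ 2 / (8 * H)))).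
  rewrite ler_expR /e -/H -yy.
  have -> : H * (236 * q ^+ 2 / H ^+ 2 - y ^+ 2 / (8 * H ^+ 2)) =
      236 * q ^+ 2 / H - y ^+ 2 / (8 * H) by field; rewrite gt_eqF.
  by rewrite lerD2r ler_pdivrMr //; nra.
rewrite expRD ler_wpM2l ?expR_ge0 // expRN lef_pV2 ?posrE ?expR_gt0 ?expR_ge1Dx //.
have : 0 <= y ^+ 2 / (8 * H) by rewrite divr_ge0 ?sqr_ge0 ?mulr_ge0 ?ler0n.
lra.
Qed.

End Window.

(** * The pair of strings *)

(** As [G + x >= 1], [(G + x)(G + x + 1)] is at most [4 (G^2 + x^2)], so the sum is dominated by a
    telescoping one. *)
Lemma cauchy_sum (R : realFieldType) (G : R) n : 1 <= G ->
  \sum_(i < n) G ^+ 2 / (G ^+ 2 + i%:R ^+ 2) <= 4 * G.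
Proof.
move=> G1; have G0 : 0 < G by lra.
apply: (@le_trans _ _ (4 * G - 4 * G ^+ 2 / (G + n%:R))); last first.
  by rewrite lerBlDr lerDl divr_ge0 ?addr_ge0 ?mulr_ge0 ?sqr_ge0 // ltW.
elim: n => [|n IH].
  have -> : 4 * G - 4 * G ^+ 2 / (G + 0%:R) = 0 by rewrite addr0; field; rewrite gt_eqF.
  by rewrite big_ord0.
rewrite big_ord_recr /=; apply: le_trans (lerD IH (lexx _)) _.
have : 0 <= n%:R :> R by []; rewrite -[n.+1%:R]natr1; move: n%:R => x x0.
have Gx : 0 < G + x by lra.
suff : G ^+ 2 / (G ^+ 2 + x ^+ 2) <= 4 * G ^+ 2 / (G + x) - 4 * G ^+ 2 / (G + (x + 1)) by lra.
have -> : 4 * G ^+ 2 / (G + x) - 4 * G ^+ 2 / (G + (x + 1)) =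
    G ^+ 2 * (4 / ((G + x) * (G + (x + 1)))).
  by field; rewrite !gt_eqF //; lra.
rewrite ler_wpM2l ?sqr_ge0 // -[leLHS]mul1r ler_pdivrMr; last by nra.
rewrite mulrAC ler_pdivlMr; last by rewrite mulr_gt0 //; lra.
have : 0 <= (G + x - 1) * (G + x) by rewrite mulr_ge0; lra.
by have := sqr_ge0 (G - x); lra.
Qed.

Lemma centered_cauchy_sum (R : realFieldType) (G : R) c n : 1 <= G -> (c <= n)%N ->
  \sum_(k < n) G ^+ 2 / (G ^+ 2 + (k%:R - c%:R) ^+ 2) <= 8 * G.
Proof.
move=> G1 cn; rewrite -(subnKC cn) big_split_ord /=.
have -> : 8 * G = 4 * G + 4 * G by ring.
apply: lerD; last first.
  apply: le_trans (cauchy_sum _ G1); rewrite le_eqVlt; apply/orP; left; apply/eqP.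
  by apply: eq_bigr => i _; rewrite natrD addrAC subrr add0r.
(* Reversed, the left part has the distances 1 to [c]; a term at distance 0 is added. *)
apply: le_trans (cauchy_sum c.+1 G1); rewrite big_ord_recl /=.
rewrite (reindex_inj rev_ord_inj) /= -[leLHS]add0r lerD //.
  by rewrite divr_ge0 ?addr_ge0 ?sqr_ge0.
apply: ler_sum => i _; rewrite natrB // addrAC subrr add0r sqrrN /bump /=.
by rewrite add1n.
Qed.

Lemma fact_le_expn n : (n`! <= n ^ n)%N.
Proof.
elim: n => // n IH; rewrite factS expnS leq_mul2l /=; apply: leq_trans IH _.
by case: n => // n; rewrite leq_exp2r.
Qed.

(* [c] is the centre of the window and [h] its half-width. No position is at
   distance more than [2 h] from a shifted centre, so the window vanishes there
   beyond distance [h]; margins of length at least [r ^ 2] stay unbiased. *)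
Definition block_sizes n r c h := [/\ (64 * r ^ 2 <= h)%N, (8 * h <= 53 ^ 2 * r ^ 2)%N,
  (c + 2 * r <= h.*2)%N, (n <= c + h.*2)%N &
  (r ^ 2 + h + 2 * r <= c)%N /\ (r ^ 2 + c + h + 2 * r < n)%N].

(** Since [r + 1 <= 2 r], [n < 1024 r^2], hence [8 h < 2731 r^2 <= 53^2 r^2]: this is where 53 comes
    from. *)
Lemma block_sizes_exist n r : (0 < r)%N -> (256 * r ^ 2 <= n < 256 * r.+1 ^ 2)%N ->
  block_sizes n r (n %/ 2) (n %/ 3).
Proof.
move=> r0 /andP[sn nr].
have nr4 : (n < 1024 * r ^ 2)%N.
  apply: leq_trans nr _; rewrite -[1024%N]/(256 * 2 ^ 2)%N -mulnA -expnMn leq_mul2l /=.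
  by rewrite leq_exp2r // mul2n -addnn -addn1 leq_add2l.
have rs : (r <= r ^ 2)%N by rewrite -mulnn leq_pmulr.
rewrite /block_sizes; move: (r ^ 2)%N (divn_eq n 2) (divn_eq n 3) sn nr4 rs => s.
move: (@ltn_pmod n 2 isT) (@ltn_pmod n 3 isT); clear nr.
move: (n %/ 2)%N (n %/ 3)%N (n %% 2)%N (n %% 3)%N => a b a' b' *.
by split; [lia | lia | lia | lia | split; lia].
Qed.

Section Construction.
Variables (R : realType) (n r c h : nat) (eps : R).
Hypotheses (r_ge1 : (0 < r)%N) (sizes : block_sizes n r c h).
Hypotheses (eps_gt0 : 0 < eps) (eps_le : 2 * eps <= 1).

Let M := (2 * r)%N.

Let h_gt0 : (0 < h)%N.
Proof.
have [rh _ _ _ _] := sizes.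
by apply: leq_trans rh; rewrite muln_gt0 expn_gt0 r_ge1.
Qed.

Definition offset (s : R) x k : R :=
  s * (-1) ^+ k * eps * window h (k%:R - c%:R - x%:R).

Let offset_far s x k : (x <= M)%N -> (k < n)%N ->
  (h < k - (c + x))%N || (h < c + x - k)%N -> offset s x k = 0.
Proof.
move=> xM kn far; have [_ _ cM ch _] := sizes.
rewrite /offset -addrA -opprD -natrD window_eq0 ?mulr0 //; move: xM far; rewrite /M; clear -kn cM ch; lia.
Qed.

Let offset_bound s x k : `|s| = 1 -> (x <= M)%N -> (k < n)%N -> `|offset s x k| <= eps.
Proof.
move=> s1 xM kn; have [far|near] := boolP ((h < k - (c + x)) || (h < c + x - k))%N.
  by rewrite offset_far // normr0 ltW.
rewrite /offset normrM -[leRHS]mulr1 ler_pM //.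
  by rewrite !normrM s1 normrX normrN1 expr1n !mul1r ger0_norm // ltW.
set y := _ - x%:R; have yh : `|y| <= h%:R.
  have -> : y = k%:R - (c + x)%:R by rewrite /y natrD opprD addrA.
  by rewrite ler_distlC; apply/andP; split; rewrite ?lerBlDr -?natrD ler_nat; clear -near; lia.
by rewrite ger0_norm ?window_ge0 ?window_le1.
Qed.

Lemma prob_string_offset s : `|s| = 1 ->
  prob_string (fun k : 'I_n => 2^-1 + offset s 0 k).
Proof.
move=> s1 k; have := offset_bound s1 (leq0n M) (ltn_ord k).
by rewrite ler_norml => /andP[e1 e2]; apply/andP; split; move: eps_le; lra.
Qed.

Let dist_offset k :
  `|(2^-1 + offset 1 0 k) - (2^-1 + offset (-1) 0 k)| = 2 * eps * `|window h (k%:R - c%:R)|.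
Proof.
have -> : (2^-1 + offset 1 0 k) - (2^-1 + offset (-1) 0 k) =
    2 * ((-1) ^+ k * eps * window h (k%:R - c%:R)) by rewrite /offset subr0; ring.
by rewrite !normrM normrX normrN1 expr1n normr_nat mul1r (gtr0_norm eps_gt0) mulrA.
Qed.

(** Here the squared distance is at most [r^2 <= h / 64]. These [r] positions give both lower bounds
    on the distance of the strings. *)
Let window_near k : (c <= k < c + r)%N -> 2^-1 <= `|window h (k%:R - c%:R : R)|.
Proof.
move=> /andP[ck kc]; have [rh hr cM ch [r2c r2n]] := sizes.
have r2 : (r <= r ^ 2)%N by rewrite -mulnn leq_pmulr.
have hR : 0 < h%:R :> R by rewrite ltr0n.
have y0 : 0 <= k%:R - c%:R :> R by rewrite subr_ge0 ler_nat.
have yr : k%:R - c%:R <= r%:R :> R by rewrite lerBlDl -natrD ler_nat ltnW.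
have rR1 : r%:R <= h%:R :> R by rewrite ler_nat; clear -r2 rh; lia.
have r2h : 64 * r%:R ^+ 2 <= h%:R :> R by rewrite -natrX -natrM ler_nat.
apply: le_trans (ler_norm _); apply: le_trans (window_ge _ _); last 2 first.
- by rewrite ger0_norm //; apply: le_trans rR1.
- exact: h_gt0.
suff : (k%:R - c%:R) ^+ 2 / h%:R <= 2^-1 :> R by lra.
rewrite ler_pdivrMr //; apply: (@le_trans _ _ (r%:R ^+ 2)); last by lra.
by rewrite lerXn2r ?nnegrE.
Qed.

Lemma max_dist_offset : eps <= \big[Num.max/0]_(k < n)
  `|(2^-1 + offset 1 0 k) - (2^-1 + offset (-1) 0 k)|.
Proof.
have [_ _ cM ch [r2c r2n]] := sizes; have cn : (c < n)%N by clear -r2n; lia.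
apply: le_trans (le_bigmax _ _ (Ordinal cn)); rewrite dist_offset /=.
have /window_near : (c <= c < c + r)%N by rewrite leqnn -[X in (X < _)%N]addn0 ltn_add2l.
move=> w; have := ler_wpM2l (ltW eps_gt0) w; lra.
Qed.

Lemma sum_dist_offset_ge : eps * r%:R <= \sum_(k < n)
  `|(2^-1 + offset 1 0 k) - (2^-1 + offset (-1) 0 k)|.
Proof.
have [_ _ cM ch [r2c r2n]] := sizes; have cr : (c + r <= n)%N by clear -r2n; lia.
rewrite -(big_mkord xpredT (fun k => `|(2^-1 + offset 1 0 k) - (2^-1 + offset (-1) 0 k)|)).
rewrite (@big_cat_nat _ _ _ c) ?leq0n //=; last by clear -cr; lia.
rewrite (@big_cat_nat _ _ _ (c + r) c) ?leq_addr //=.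
rewrite -[leLHS]add0r lerD ?sumr_ge0 // -[leLHS]addr0 lerD ?sumr_ge0 //.
have -> : eps * r%:R = \sum_(c <= k < c + r) eps.
  by rewrite sumr_const_nat addKn mulr_natr.
apply: ler_sum_nat => k kc; rewrite dist_offset.
by have := ler_wpM2l (ltW eps_gt0) (window_near kc); lra.
Qed.

(** Beyond distance [h + M] from [c] the window vanishes for every shift up to [M], so 0 serves as a
    bound there. *)
Let W k : {poly R} :=
  if ((k <= c + h + M) && (c <= k + h + M))%N then window_poly h M (k%:R - c%:R) else 0.

Let W_ge0 k : coef_ge0 (W k).
Proof.
by rewrite /W; case: ifP => _; [apply: window_poly_ge0 | move=> i; rewrite coef0].
Qed.

Let window_diff_bound N k : (k < n)%N ->
  diff_bound M (fun x => (window h (k%:R - c%:R - x%:R))%:M : 'M[R]_N.+1) (W k).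
Proof.
move=> kn; have [_ _ cM ch _] := sizes; rewrite /W; case: ifP => [_|far].
  exact: window_diff_bound.
apply: (@diff_bound_ext _ _ _ _ (fun=> 0)) => [x xM|].
  rewrite -addrA -opprD -natrD window_eq0 ?raddf0 //; clear -xM far kn cM ch; lia.
by rewrite -polyC0; apply/diff_bound_cst/row_norm0.
Qed.

Let rR : 0 < r%:R :> R. Proof. by rewrite ltr0n. Qed.

Let W_horner_ge0 k : 0 <= (W k).[4 * r%:R].
Proof.
by rewrite horner_coef sumr_ge0 // => i _; rewrite mulr_ge0 ?W_ge0 ?exprn_ge0 ?mulr_ge0.
Qed.

(** With [8 h <= (53 r)^2] the rational bound becomes a Cauchy kernel of width [53 r], whose sum is
    of order [r]. *)
Let W_horner k : (W k).[4 * r%:R] <=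
  expR 4 * ((53 * r%:R) ^+ 2 / ((53 * r%:R) ^+ 2 + (k%:R - c%:R) ^+ 2)).
Proof.
have [rh hr cM ch [r2c r2n]] := sizes.
set y := k%:R - c%:R; set G := 53 * r%:R.
have G0 : 0 < G by rewrite mulr_gt0.
have hG : 8 * h%:R <= G ^+ 2.
  rewrite /G exprMn -!natrX -!natrM ler_nat.
  exact: hr.
have Gy : 0 < G ^+ 2 + y ^+ 2 by rewrite ltr_wpDr ?sqr_ge0 ?exprn_gt0.
rewrite /W; case: ifP => [/andP[kc ck]|_]; last first.
  by rewrite horner0 mulr_ge0 ?expR_ge0 // divr_ge0 ?sqr_ge0 // ltW.
apply: le_trans (window_poly_horner r_ge1 rh _) _.
  rewrite -natrM -natrD /y ler_distlC.
  by apply/andP; split; rewrite ?lerBlDr -?natrD ler_nat; clear -kc ck; lia.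
rewrite ler_wpM2l ?expR_ge0 //.
have h8 : 0 < 8 * h%:R :> R by rewrite mulr_gt0 // ltr0n.
have v : y ^+ 2 / G ^+ 2 <= y ^+ 2 / (8 * h%:R).
  by rewrite ler_wpM2l ?sqr_ge0 // lef_pV2 ?posrE ?exprn_gt0.
have -> : G ^+ 2 / (G ^+ 2 + y ^+ 2) = (1 + y ^+ 2 / G ^+ 2)^-1.
  by field; rewrite !gt_eqF.
have v0 : 0 <= y ^+ 2 / G ^+ 2 by rewrite divr_ge0 ?sqr_ge0.
by rewrite lef_pV2 ?posrE ?lerD2l // ltr_pwDl // (le_trans v0).
Qed.

Let W_sum : \sum_(k < n) (W k).[4 * r%:R] <= 424 * expR 4 * r%:R.
Proof.
apply: (@le_trans _ _ (\sum_(k < n) expR 4 *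
    ((53 * r%:R) ^+ 2 / ((53 * r%:R) ^+ 2 + (k%:R - c%:R) ^+ 2)))).
  by apply: ler_sum => k _; apply: W_horner.
have [_ _ cM ch [r2c r2n]] := sizes.
rewrite -mulr_sumr [leRHS](_ : _ = expR 4 * (8 * (53 * r%:R))); last by ring.
rewrite ler_wpM2l ?expR_ge0 //; apply: centered_cauchy_sum; last first.
  by apply: leq_trans (ltnW r2n); rewrite -!addnA addnCA leq_addr.
have : 1 <= r%:R :> R by rewrite ler1n.
lra.
Qed.

(** The difference of order 0 at shift 0 is the window itself, so [W_sum] bounds its sum. *)
Lemma sum_dist_offset_le : \sum_(k < n)
  `|(2^-1 + offset 1 0 k) - (2^-1 + offset (-1) 0 k)| <= 848 * eps * expR 4 * r%:R.
Proof.
rewrite [leRHS](_ : _ = 2 * eps * (424 * expR 4 * r%:R)); last by ring.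
apply: le_trans (ler_wpM2l _ W_sum); last by rewrite mulr_ge0 // ltW.
rewrite mulr_sumr; apply: ler_sum => k _; rewrite dist_offset ler_wpM2l //.
  by rewrite mulr_ge0 // ltW.
have t0 : 0 < 4 * r%:R :> R by rewrite mulr_gt0.
have M0 : (0 + 0 <= M)%N by [].
have := diff_bound_horner (window_diff_bound 0 (ltn_ord k)) M0 (@W_ge0 k) t0.
by rewrite fact0 expr0 divr1 mul1r /= subr0 => H; apply: le_trans H; exact: le_row_norm_scalar.
Qed.

(** * Matrix products of the two strings and their differences *)

Variables (N : nat) (d : R).
Hypotheses (d_gt0 : 0 < d) (d_le1 : d <= 1) (rd : 64 <= r.+1%:R * d).

Let S b := append_mx R N b.
Let beta : 'M[R]_N.+1 := 2^-1 *: (S true + S false).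
Let P : 'M[R]_N.+1 := d%:M + (1 - d) *: beta.
Let Q : 'M[R]_N.+1 := (1 - d) *: (S true - S false).

Let B s x k := bit_mx N d (2^-1 + offset s x k).
Let F s x := \prod_(k < n) B s x k.

Let bit_split e : bit_mx N d (2^-1 + e) = P + e%:M * Q.
Proof.
rewrite -mulmxE mul_scalar_mx /bit_mx /P /Q /beta -/(S true) -/(S false).
apply/matrixP => i j; move: (S true) (S false) (d%:M) => S1 S0 I.
by rewrite !mxE; field.
Qed.

Let row_norm_bit a : 0 <= a <= 1 -> row_norm (bit_mx N d a) <= 1.
Proof.
case/andP=> a0 a1; apply: le_trans (row_normD _ _) _.
rewrite [leRHS](_ : 1 = d + (1 - d) * (a * 1 + (1 - a) * 1)); last by ring.
apply: lerD; first by apply: le_trans (row_norm_scalar _ _) _; rewrite ger0_norm // ltW.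
apply: le_trans (row_normZ _ _) _; rewrite ger0_norm ?subr_ge0 //.
apply: ler_wpM2l; first by rewrite subr_ge0.
apply: le_trans (row_normD _ _) _; apply: lerD; apply: le_trans (row_normZ _ _) _;
  by rewrite ger0_norm ?subr_ge0 // ler_wpM2l ?subr_ge0 // row_norm_append_mx.
Qed.

Let row_norm_beta : row_norm beta <= 1.
Proof.
apply: le_trans (row_normZ _ _) _; rewrite ger0_norm ?invr_ge0 // ler_pdivrMl //.
apply: le_trans (row_normD _ _) _; have := row_norm_append_mx R N true.
have := row_norm_append_mx R N false; rewrite /S; lra.
Qed.

Let row_norm_Q : row_norm Q <= 2.
Proof.
apply: le_trans (row_normZ _ _) _; rewrite ger0_norm ?subr_ge0 //.
rewrite [leRHS](_ : 2 = 1 * (1 + 1)); last by ring.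
apply: ler_pM; [by rewrite subr_ge0 | exact: row_norm_ge0 | by rewrite gerBl ltW | ].
by apply: le_trans (row_normB _ _) _; apply: lerD; apply: row_norm_append_mx.
Qed.

Let P_bit : P = bit_mx N d (2^-1 + 0).
Proof. by rewrite bit_split raddf0 mul0r addr0. Qed.

Let row_norm_P : row_norm P <= 1.
Proof. by rewrite P_bit; apply: row_norm_bit; lra. Qed.

Let row_norm_B s x k : `|s| = 1 -> (x <= M)%N -> (k < n)%N -> row_norm (B s x k) <= 1.
Proof.
move=> s1 xM kn; have := offset_bound s1 xM kn; rewrite ler_norml => /andP[e1 e2].
by apply: row_norm_bit; move: eps_le; lra.
Qed.

(** At shift 0, [a] and [b] are the lengths of the unbiased margins around the [h.*2.+1] positions
    of the middle block. *)
Let a := (c - h)%N.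
Let b := (n - c - h.+1)%N.
Let L s := \prod_(0 <= k < h.*2.+1) B s 0 (k + a).

(** The window moves by [x] while the signs stay; read from the moved block, all signs are
    multiplied by [(-1) ^+ x]. *)
Let F_shift s x : (x <= M)%N ->
  F s x = P ^+ (a + x) * L (s * (-1) ^+ x) * P ^+ (b - x).
Proof.
move=> xM; have [_ _ cM ch [r2c r2n]] := sizes.
rewrite /F -(big_mkord xpredT (B s x)).
rewrite (@big_cat_nat _ _ _ (a + x)) ?leq0n //=; last by rewrite /a; clear -xM cM ch r2c r2n; lia.
rewrite (@big_cat_nat _ _ _ (h.*2.+1 + (a + x)) (a + x)) ?leq_addl //=; last by rewrite /a; clear -xM cM ch r2c r2n; lia.
rewrite mulrA; congr (_ * _ * _).
- rewrite (eq_big_nat _ _ (F2 := fun=> P)) ?prodr_const_nat ?subn0 // => k /andP[_ kax].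
  by rewrite /B offset_far ?P_bit //; move: kax; rewrite /a; clear -xM cM ch r2c r2n; lia.
- rewrite -{1}[(a + x)%N]add0n big_addn addnK; apply: eq_bigr => k _.
  congr (bit_mx _ _ (_ + _)); rewrite /offset !natrD subr0.
  congr (_ * _ * window _ _); last by ring.
  by rewrite !exprD; ring.
- rewrite (eq_big_nat _ _ (F2 := fun=> P)) ?prodr_const_nat => [|k /andP[kax kn]].
    by congr (_ ^+ _); rewrite /a /b; clear -xM cM ch r2c r2n; lia.
  by rewrite /B offset_far ?P_bit //; move: kax; rewrite /a; clear -xM cM ch r2c r2n; lia.
Qed.

Let row_norm_L s : `|s| = 1 -> row_norm (L s) <= 1.
Proof.
move=> s1; have [_ _ cM ch [r2c r2n]] := sizes.
apply: row_norm_prod1 => k; rewrite mem_index_iota => /andP[_ kh].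
by apply: row_norm_B => //; rewrite /a; clear -kh ch r2c r2n; lia.
Qed.

Let D x := F 1 x - F (-1) x.

(** An odd shift interchanges the two blocks, which the sign undoes. *)
Let D_sign x : (x <= M)%N ->
  (-1) ^+ x *: D x = P ^+ (a + x) * (L 1 - L (-1)) * P ^+ (b - x).
Proof.
move=> xM; rewrite /D !F_shift // -mulrBl -mulrBr mul1r mulN1r.
rewrite -signr_odd; case: (odd x); rewrite ?expr1 ?expr0 ?opprK.
  by rewrite scaleN1r -mulNr -mulrN opprB.
by rewrite scale1r.
Qed.

Let fdiff_D_sign x : (x + r <= M)%N ->
  row_norm (fdiff r (fun y => (-1) ^+ y *: D y) x) <= 2 * 4^-1 ^+ r.
Proof.
move=> xr; have [_ _ cM ch [r2c r2n]] := sizes.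
rewrite (@eq_fdiff _ _ _ _ (fun y => P ^+ (a + y) * (L 1 - L (-1)) * P ^+ (b - y))); last first.
  by move=> y yx; apply: D_sign; apply: leq_trans xr.
rewrite fdiff_sandwich; last by rewrite /b; clear -xr cM ch r2c r2n; lia.
have PG : P = (1 - d) *: (beta - 1) + 1.
  rewrite /P -[1 : 'M[R]_N.+1]/(1%:M) -[d%:M]scalemx1; apply/matrixP => i j.
  by move: beta (1%:M) => X I; rewrite !mxE; ring.
(* The margins of [block_sizes] provide the [r * r] powers that [r] commutators consume on each
   side. *)
have -> : (a + x = r * r + (a + x - r * r))%N by rewrite /a; clear -xr cM ch r2c r2n; lia.
have -> : (b - x - r = r * r + (b - x - r - r * r))%N by rewrite /b; clear -xr cM ch r2c r2n; lia.
apply: le_trans (@row_norm_iter_comm _ _ P ((1 - d) *: (beta - 1)) _ 8^-1 r r _ _ _ _ _ _) _.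
- move=> V; rewrite {1 2}PG mulrDl mulrDr mul1r mulr1 opprD addrACA subrr addr0 //.
- by rewrite /GRing.comm PG mulrDl mulrDr mul1r mulr1.
- exact: row_norm_P.
- exact: row_norm_smoothing.
rewrite mulrC ler_pM ?exprn_ge0 ?row_norm_ge0 //.
- by rewrite mulr_ge0 // invr_ge0.
- by apply: le_trans (row_normB _ _) _; apply: lerD; apply: row_norm_L; rewrite ?normrN normr1.
- by rewrite lerXn2r ?nnegrE ?mulr_ge0 ?invr_ge0 //; lra.
Qed.

Let F_diff_bound s : `|s| = 1 ->
  diff_bound M (F s) (\prod_(k < n) (1 + (2 * eps)%:P * W k)).
Proof.
move=> s1; apply: diff_bound_prod => k.
apply: (@diff_bound_ext _ _ _ _ (fun x => P + (s * (-1) ^+ k * eps)%:M *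
    (window h (k%:R - c%:R - x%:R))%:M * Q)).
  move=> x _; rewrite /B bit_split /offset.
  by rewrite [(_ * window _ _)%:M]scalar_mxM.
apply: diff_boundD; first by rewrite -polyC1; apply: diff_bound_cst.
have -> : (2 * eps)%:P * W k = eps%:P * W k * 2%:P by rewrite polyCM; ring.
apply: diff_boundM; last exact: diff_bound_cst.
apply: diff_boundM; last exact: window_diff_bound.
apply: diff_bound_cst; apply: le_trans (row_norm_scalar _ _) _.
by rewrite !normrM s1 normrX normrN1 expr1n !mul1r ger0_norm // ltW.
Qed.

(** Evaluation at [4 r] gives [r! / (4 r)^r <= 4^-r], and [1 + u <= expR u] turns the product into
    the exponential of [W_sum]. *)
Let fdiff_F s x : `|s| = 1 -> (x + r <= M)%N ->
  row_norm (fdiff r (F s) x) <= 4^-1 ^+ r * expR (848 * eps * expR 4 * r%:R).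
Proof.
move=> s1 xr.
have p0 : coef_ge0 (\prod_(k < n) (1 + (2 * eps)%:P * W k)).
  apply: coef_ge0_prod => k; apply: coef_ge0D; first by rewrite -polyC1; apply: coef_ge0C.
  by apply: coef_ge0M => //; apply: coef_ge0C; rewrite mulr_ge0 // ltW.
have t0 : 0 < 4 * r%:R :> R by rewrite mulr_gt0.
apply: le_trans (diff_bound_horner (F_diff_bound s1) xr p0 t0) _.
apply: ler_pM.
- by rewrite divr_ge0 ?exprn_ge0 ?invr_ge0 // ltW.
- by rewrite horner_coef sumr_ge0 // => i _; rewrite mulr_ge0 // exprn_ge0 // ltW.
- rewrite ler_pdivrMr ?exprn_gt0 // -exprMn mulrA mulVf ?mul1r; last by rewrite pnatr_eq0.
  by rewrite -natrX ler_nat fact_le_expn.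
- rewrite horner_prod; apply: (@le_trans _ _ (\prod_(k < n) expR (2 * eps * (W k).[4 * r%:R]))).
    apply: ler_prod => k _; rewrite !hornerE /=.
    have : 0 <= 2 * eps * (W k).[4 * r%:R] by rewrite mulr_ge0 // mulr_ge0 // ltW.
    by move=> ?; rewrite expR_ge1Dx andbT addr_ge0.
  rewrite -expR_sum ler_expR -mulr_sumr.
  rewrite [leRHS](_ : _ = 2 * eps * (424 * expR 4 * r%:R)); last by ring.
  by rewrite ler_wpM2l // mulr_ge0 // ltW.
Qed.

(** [row_norm_alternating] is used with both orders equal to [r], hence [M = 2 r]. Its loss [2 ^+ r]
    against [4^-1 ^+ r] leaves [2^-1 ^+ r]. *)
Let row_norm_D0 : 848 * eps * expR 4 <= 4^-1 ->
  row_norm (D 0) <= 4 * 2^-1 ^+ r * expR (4^-1 * r%:R).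
Proof.
move=> eps_small; set E := expR _.
have E1 : 1 <= E.
  by rewrite -[leLHS]expR0 ler_expR mulr_ge0 ?invr_ge0 ?ler0n.
have FE s x : `|s| = 1 -> (x + r <= M)%N -> row_norm (fdiff r (F s) x) <= 4^-1 ^+ r * E.
  move=> s1 xr; apply: le_trans (fdiff_F s1 xr) _.
  by rewrite ler_wpM2l ?exprn_ge0 ?invr_ge0 // ler_expR ler_wpM2r // ltW.
have e1 : 0 <= 2 * (4^-1 ^+ r * E) by rewrite !mulr_ge0 ?expR_ge0 ?exprn_ge0 ?invr_ge0.
have e2 : 0 <= 2 * 4^-1 ^+ r :> R by rewrite mulr_ge0 ?exprn_ge0 ?invr_ge0.
have rM : (r + r <= M)%N by rewrite /M mul2n addnn.
apply: le_trans (@row_norm_alternating _ _ M r r D _ _ rM e1 e2 _ fdiff_D_sign) _.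
  move=> x xr; rewrite /D fdiffD fdiffN; apply: le_trans (row_normB _ _) _.
  by rewrite mulr_natl mulr2n; apply: lerD; apply: FE; rewrite ?normrN ?normr1.
have -> : (4^-1 : R) = 2^-1 * 2^-1 by rewrite -invfM -natrM.
rewrite [X in _ <= _ * X * _](_ : 2^-1 ^+ r = 2 ^+ r * (2^-1 * 2^-1) ^+ r); last first.
  by rewrite -exprMn mulrA divff ?mul1r ?pnatr_eq0.
set z := 2 ^+ r * _ ^+ r; have z0 : 0 <= z by rewrite mulr_ge0 ?exprn_ge0 ?mulr_ge0 ?invr_ge0.
rewrite [leLHS](_ : _ = 2 * z * (E + 1)); last by rewrite /z; ring.
have : 0 <= z * (E - 1) by rewrite mulr_ge0 // subr_ge0.
lra.
Qed.

Lemma trace_tv_offset : 848 * eps * expR 4 <= 4^-1 -> (2 ^ n.+1 <= N.+1)%N ->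
  trace_tv (fun k : 'I_n => 2^-1 + offset 1 0 k) (fun k : 'I_n => 2^-1 + offset (-1) 0 k) d
  <= 2 * 2^-1 ^+ r * expR (4^-1 * r%:R).
Proof.
move=> eps_small Nn; apply: le_trans (trace_tv_le d _ _ Nn) _.
rewrite ler_pdivrMl // !mulrA -natrM; exact: row_norm_D0.
Qed.

End Construction.

(** [r] is the integer part of [sqrt n / 16]. *)
Lemma square_bracket n : exists r, (256 * r ^ 2 <= n < 256 * r.+1 ^ 2)%N.
Proof.
have ex : exists r, (256 * r ^ 2 <= n)%N by exists 0%N.
have bd r : (256 * r ^ 2 <= n -> r <= n)%N.
  by move=> rn; apply: leq_trans rn; case: r => // r; rewrite -mulnn; lia.
case: (ex_maxnP ex bd) => r rn rmax; exists r.
by rewrite rn ltnNge; apply/negP => /rmax; rewrite ltnn.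
Qed.

Theorem theorem1 (R : realType) :
  exists (c eps A B C : R), 0 < c /\ 0 < eps /\ 0 < A /\ 0 < B /\ 0 < C /\
  exists N : nat, forall n : nat, (N <= n)%N ->
    exists p p' : 'I_n -> R,
      [/\ prob_string p, prob_string p',
          eps <= \big[Num.max/0]_(i < n) `|p i - p' i|,
          A * Num.sqrt (n%:R) <= \sum_(i < n) `|p i - p' i| <= B * Num.sqrt (n%:R) &
          forall d : R, c / Num.sqrt (n%:R) <= d -> d < 1 ->
            trace_tv p p' d <= expR (- (C * Num.sqrt (n%:R)))].
Proof.
(* Makes the exponent in [fdiff_F] equal to [r / 4], so that its growth loses against [2^-r]. *)
pose eps : R := (4 * 848 * expR 4)^-1.
have E0 : 1 <= expR 4 :> R by rewrite -[leLHS]expR0 ler_expR.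
have eps0 : 0 < eps by rewrite invr_gt0 !mulr_gt0 ?expR_gt0.
have epsE : 848 * eps * expR 4 = 4^-1.
  by rewrite /eps; field; rewrite gt_eqF ?expR_gt0.
have eps1 : 2 * eps <= 1.
  have : 0 <= eps * (expR 4 - 1) by rewrite mulr_ge0 ?subr_ge0 // ltW.
  by move: epsE; lra.
(* 1024 is 64 times 16, as [q <= 16 (r + 1)] must yield [64 <= (r + 1) d]; [eps / 32] and 1/256 rest
   on [q <= 32 r]. *)
exists 1024, eps, (eps / 32), 1, 256^-1.
do 4 (split; first by rewrite ?divr_gt0).
split; first by rewrite invr_gt0.
(* Ensures [r >= 8], so that the final exponent [1 - r / 4] is at most [- r / 8], hence at most
   [- q / 256]. *)
exists (256 * 8 ^ 2)%N => n nN.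
have [r /andP[rn nr]] := square_bracket n.
have r8 : (8 <= r)%N.
  rewrite leqNgt; apply/negP => r8; have : (r.+1 ^ 2 <= 8 ^ 2)%N by rewrite leq_exp2r.
  by move: nr nN; lia.
have r1 : (0 < r)%N by apply: leq_trans r8.
set q := Num.sqrt _; have q2 : q ^+ 2 = n%:R by rewrite sqr_sqrtr.
have q0 : 0 <= q by apply: sqrtr_ge0.
have rq : 16 * r%:R <= q.
  rewrite -(@ler_pXn2r _ 2) ?nnegrE ?mulr_ge0 // q2 exprMn -!natrX -natrM ler_nat.
  exact: rn.
have qr : q <= 16 * r.+1%:R.
  rewrite -(@ler_pXn2r _ 2) ?nnegrE ?mulr_ge0 // q2 exprMn -!natrX -natrM ler_nat.
  exact: ltnW.
have rR8 : 8 <= r%:R :> R by rewrite ler_nat.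
have qr' : q <= 32 * r%:R by move: qr; rewrite -[r.+1%:R]natr1; lra.
have := block_sizes_exist r1 (introT andP (conj rn nr)).
move: (n %/ 2)%N (n %/ 3)%N => c h sz.
exists (fun k : 'I_n => 2^-1 + offset c h eps 1 0 k).
exists (fun k : 'I_n => 2^-1 + offset c h eps (-1) 0 k).
split.
- by apply: (prob_string_offset sz) => //; rewrite normr1.
- by apply: (prob_string_offset sz) => //; rewrite normrN normr1.
- exact: (max_dist_offset r1 sz).
- apply/andP; split.
    apply: le_trans (sum_dist_offset_ge r1 sz eps0).
    by have := ler_wpM2l (ltW eps0) qr'; lra.
  apply: le_trans (sum_dist_offset_le r1 sz eps0) _.
  by rewrite epsE; lra.
- move=> d dge d1.
  have qp : 0 < q by apply: lt_le_trans rq; lra.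
  have d0 : 0 < d by apply: lt_le_trans dge; rewrite divr_gt0.
  have rd : 64 <= r.+1%:R * d.
    move: dge; rewrite ler_pdivrMr // => dq.
    have : 0 <= d * (16 * r.+1%:R - q) by rewrite mulr_ge0 ?subr_ge0 // ltW.
    lra.
  have eps_small : 848 * eps * expR 4 <= 4^-1 by rewrite epsE.
  apply: le_trans (trace_tv_offset r1 sz eps0 eps1 d0 (ltW d1) rd eps_small (leqnSn _)) _.
  have e2 : 2 <= expR 1 :> R by have := expR_ge1Dx (1 : R); lra.
  have er : 2^-1 ^+ r <= expR (- (2^-1 * r%:R)) :> R.
    rewrite mulrC -mulrN expRM_natl lerXn2r ?nnegrE ?expR_ge0 ?invr_ge0 //.
    by have := expR_ge1Dx (- 2^-1 : R); lra.
  apply: (@le_trans _ _ (expR 1 * expR (- (2^-1 * r%:R)) * expR (4^-1 * r%:R))).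
    by rewrite ler_wpM2r ?expR_ge0 // ler_pM ?exprn_ge0 ?invr_ge0.
  by rewrite -!expRD ler_expR; lra.
Qed.
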